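(* Let $\mathcal{X}$ be a topological space with Borel $\sigma$-algebra $\mathcal{B}$, and let $\{\mu_n\}_{n\in\mathbb{N}}$ be a sequence of probability measures on $\mathcal{B}$ that satisfies a large deviations principle with rate function $J\colon \mathcal{X}\to[0,\infty]$. Let $\phi\colon\mathcal{X}\to\mathbb{R}$ be an upper semicontinuous function. Then $$\limsup_{n\to\infty}\frac1n\log\int_{\mathcal{X}} e^{n\phi(x)}\,\mu_n(\mathrm{d}x)\;\le\;\sup_{x\in\mathcal{X}}\left[\phi(x)-J(x)\right]$$ if and only if $$\lim_{M\to\infty}\limsup_{n\to\infty}\frac1n\log\int_{\mathcal{X}} e^{n\phi(x)}\,\mathbf{1}_{\{\phi(x)>M\}}\,\mu_n(\mathrm{d}x)\;\le\;\sup_{x\in\mathcal{X}}\left[\phi(x)-J(x)\right].$$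
   Context: The sequence $\{\mu_n\}_{n\in\mathbb{N}}$ (indexed by positive integers) of probability measures on the Borel $\sigma$-algebra of $\mathcal{X}$ satisfies a large deviations principle (LDP) with rate function $J$ if $J\colon\mathcal{X}\to[0,\infty]$ is lower semicontinuous, $$\limsup_{n\to\infty}\frac1n\log\mu_n(F)\le-\inf_{x\in F}J(x)\quad\text{for every closed } F\subset\mathcal{X},$$ and $$\liminf_{n\to\infty}\frac1n\log\mu_n(G)\ge-\inf_{x\in G}J(x)\quad\text{for every open } G\subset\mathcal{X}.$$ It is not assumed that $J$ has compact sublevel sets (i.e. $J$ need not be a good rate function). No separation or other assumptions are made on $\mathcal{X}$. Conventions: $\exp(-\infty)=0$, $\log(0)=-\infty$, $\exp(\infty)=\log(\infty)=\infty$. All quantities take values in the extended reals $[-\infty,\infty]$; in particular $\phi(x)-J(x)=-\infty$ when $J(x)=\infty$. $\mathbf{1}_{\{\cdot\}}$ denotes the indicator function. *)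

(* Defs.v *)
From HB Require Import structures.
From mathcomp Require Export all_boot all_order all_algebra.
From mathcomp Require Export all_classical all_reals all_analysis.
Export Order.TTheory GRing.Theory Num.Theory.
Export numFieldNormedType.Exports.

Set Implicit Arguments.
Unset Strict Implicit.
Unset Printing Implicit Defensive.

Local Open Scope classical_set_scope.
Local Open Scope ring_scope.
Local Open Scope ereal_scope.

(* MathComp-Analysis requires the carrier of a measurable space to be pointed.
   This costs no generality here: a space that carries a probability measure is
   nonempty. *)
Notation borelType X := (g_sigma_algebraType (@open X)).

(* Real-valued dual of the library's [lower_semicontinuous]. *)
Definition upper_semicontinuous (X : topologicalType) (R : numFieldType)
    (f : X -> R) : Prop :=
  forall x a, (f x < a)%R -> exists2 V, nbhs x V & forall y, V y -> (f y < a)%R.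

(* The sequence is indexed by the positive integers; the term of index 0 of a
   function on nat plays no role, since [limn_esup] and [limn_einf] do not depend
   on finitely many terms. The infimum over the empty set is +oo, and
   [lne 0 = -oo]. *)
Definition satisfies_LDP (R : realType) (X : ptopologicalType)
    (mu : nat -> probability (borelType X) R) (J : X -> \bar R) : Prop :=
  [/\ forall x, 0 <= J x,
      lower_semicontinuous J,
      forall F : set X, closed F ->
        limn_esup (fun n : nat => (n%:R^-1)%:E * lne (mu n F))
          <= - ereal_inf (J @` F)
    & forall G : set X, open G ->
        - ereal_inf (J @` G)
          <= limn_einf (fun n : nat => (n%:R^-1)%:E * lne (mu n G))].

(* Main.v *)
Require Import Defs.
From mathcomp Require Import measurable_realfun lra.

(* For [c > S := sup (phi - J)], the set [phi >= a] is closed and its measure has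
   exponential rate at most [c - a]. Hence slices [a < phi <= a + d] contribute
   rate at most about [c + d], and finitely many of them together with
   [phi <= c] cover [phi <= M], since the rate of a finite sum is the largest
   rate. So the part [phi <= M] never has rate above [S], and the full integral
   has rate at most [S] as soon as the tails [phi > M] do in the limit. *)

Set Implicit Arguments.
Unset Strict Implicit.
Unset Printing Implicit Defensive.

Local Open Scope classical_set_scope.
Local Open Scope ring_scope.
Local Open Scope ereal_scope.

Section exponential_rate.
Context {R : realType}.
Implicit Types (u v : nat -> \bar R) (s : \bar R) (c : R).

Definition exp_rate u : \bar R :=
  limn_esup (fun n : nat => (n%:R^-1)%:E * lne (u n)).

(** Suprema such as [sup (phi - J)] may be infinite, whereas an exponent in [expR] must be real;
    this passes to real bounds strictly above [s]. *)
Lemma le_EFin_gt (x s : \bar R) :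
  (forall c, s < c%:E -> x <= c%:E) -> x <= s.
Proof.
case: s => [r| |] h; last 2 first.
- exact: leey.
- case: x h => [r| |] // h; last by have := h 0%R (ltNyr _).
  by have := h (r - 1)%R (ltNyr _); rewrite lee_fin lerBrDr gerDl ler10.
- by apply/lee_addgt0Pr => e e0; apply: h; rewrite lte_fin ltrDl.
Qed.

(** With [exp_rate_le], this trades the limsup of logarithms for eventual exponential bounds, which
    can be added and compared directly. *)
Lemma exp_rate_lt u c : (forall n, 0 <= u n) -> exp_rate u < c%:E ->
  \forall n \near \oo, u n <= (expR (n%:R * c))%:E.
Proof.
move=> u0 /ereal_inf_lt[_ [V Voo <-] supV].
near=> n.
have n0 : (0 < n%:R :> R)%R by rewrite ltr0n; near: n; exact: nbhs_infty_gt.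
have Vn : V n by near: n.
have : (n%:R^-1)%:E * lne (u n) <= c%:E.
  by apply: le_trans (ltW supV); apply: ereal_sup_ubound; exists n.
rewrite lee_pdivrMl// -EFinM -[in X in X -> _]lee_expeR lneK//=.
by rewrite in_itv/= u0 leey.
Unshelve. all: by end_near. Qed.

Lemma exp_rate_le u c :
  (\forall n \near \oo, u n <= (expR (n%:R * c))%:E) -> exp_rate u <= c%:E.
Proof.
move=> uc; apply: ge_ereal_inf.
(* The limsup is an infimum over neighbourhoods of infinity, so one neighbourhood suffices. It omits
   index 0, where the term is 0 and may exceed a negative [c]. *)
exists (ereal_sup ((fun n => (n%:R^-1)%:E * lne (u n)) @`
  [set n | (0 < n)%N /\ u n <= (expR (n%:R * c))%:E])).
  eexists; last by [].
  by apply: filterI => //; exact: nbhs_infty_gt.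
apply: ge_ereal_sup => _ [n [n0 un] <-].
rewrite lee_pdivrMl ?ltr0n// -EFinM.
have [un0|un0] := leP (u n) 0; first by rewrite le0_lneNy// leNye.
by rewrite -lee_expeR lneK//= in_itv/= leey ltW.
Qed.

Lemma le_exp_rate u v : (forall n, 0 <= u n) -> (forall n, u n <= v n) ->
  exp_rate u <= exp_rate v.
Proof.
move=> u0 uv; apply: le_EFin_gt => c vc; apply: exp_rate_le.
have v0 n : 0 <= v n by exact: le_trans (uv n).
by apply: filterS (exp_rate_lt v0 vc) => n /(le_trans (uv n)).
Qed.

(* For [c < c'], [2 * expR (n * c) <= expR (n * c')] as soon as
   [1 <= n * (c' - c)]. *)
Lemma exp_rateD u v s : (forall n, 0 <= u n) -> (forall n, 0 <= v n) ->
  exp_rate u <= s -> exp_rate v <= s -> exp_rate (u \+ v) <= s.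
Proof.
move=> u0 v0 us vs; apply: le_EFin_gt => c sc.
apply/lee_addgt0Pr => e e0; apply: exp_rate_le.
have := exp_rate_lt u0 (le_lt_trans us sc).
have := exp_rate_lt v0 (le_lt_trans vs sc).
move=> vc uc; near=> n.
have un : u n <= (expR (n%:R * c))%:E by near: n.
have vn : v n <= (expR (n%:R * c))%:E by near: n.
apply: (le_trans (leeD un vn)).
rewrite -EFinD lee_fin mulrDr expRD -mulr2n -[leLHS]mulr_natr.
rewrite ler_pM2l ?expR_gt0//.
apply: le_trans (expR_ge1Dx _).
suff : (1 <= n%:R * e)%R by lra.
rewrite -ler_pdivrMr// div1r.
by near: n; exact: nbhs_infty_ger.
Unshelve. all: by end_near. Qed.

End exponential_rate.

Section upper_semicontinuous_function.
Context {R : realType} {X : ptopologicalType}.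
Variable phi : X -> R.
Hypothesis hphi : upper_semicontinuous phi.

Lemma open_usc_lt (a : R) : open [set x | (phi x < a)%R].
Proof. by rewrite openE => x /= /hphi[V xV Va]; exact: filterS xV. Qed.

Lemma closed_usc_ge (a : R) : closed [set x | (a <= phi x)%R].
Proof.
have -> : [set x | (a <= phi x)%R] = ~` [set x | (phi x < a)%R].
  by apply/seteqP; split=> x /=; rewrite leNgt => /negP.
exact/open_closedC/open_usc_lt.
Qed.

(** The rays []-oo, a[] generate the Borel sets of the line, and their preimages are open. *)
Lemma measurable_usc : measurable_fun setT (phi : borelType X -> R).
Proof.
apply: (measurability _ (RGenInftyO.measurableE R)).
move=> /= _ [_ [a ->]] <-; rewrite setTI preimage_itvNyo.
by apply: sub_sigma_algebra; exact: open_usc_lt.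
Qed.

Lemma measurable_usc_itv (i : interval R) :
  measurable (phi @^-1` [set` i] : set (borelType X)).
Proof. by rewrite -[X in measurable X]setTI; exact: measurable_usc. Qed.

End upper_semicontinuous_function.

Section truncated_exponential_integral.
Context {R : realType} {X : ptopologicalType}.
Variables (mu : nat -> probability (borelType X) R) (phi : X -> R).
Hypothesis hphi : upper_semicontinuous phi.
Implicit Types (A B : set (borelType X)) (n : nat) (M : R).

Let measurable_expphi n A :
  measurable_fun A (fun x : borelType X => (expR (n%:R * phi x))%:E).
Proof.
apply: measurable_funTS; apply/measurable_EFinP.
apply: measurableT_comp => //; apply: measurable_funM => //.
exact: measurable_usc.
Qed.

Definition exp_int A n := \int[mu n]_(x in A) (expR (n%:R * phi x))%:E.

Lemma exp_int_ge0 A n : 0 <= exp_int A n.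
Proof. by apply: integral_ge0 => x _; rewrite lee_fin expR_ge0. Qed.

Lemma exp_int_indic A n :
  \int[mu n]_x (expR (n%:R * phi x) * \1_A x)%:E = exp_int A n.
Proof.
rewrite /exp_int [RHS]integral_mkcond; apply: eq_integral => x _.
by rewrite patchE indicE; case: (x \in A); rewrite ?mulr1 ?mulr0.
Qed.

Lemma exp_int_setU A B : measurable A -> measurable B -> [disjoint A & B] ->
  exp_int (A `|` B) = exp_int A \+ exp_int B.
Proof. by move=> mA mB AB; apply/funext => n; exact: ge0_integral_setU. Qed.

Lemma le_exp_int A B n : measurable A -> measurable B -> A `<=` B ->
  exp_int A n <= exp_int B n.
Proof. by move=> mA mB; exact: ge0_subset_integral. Qed.

Lemma exp_int_le_bound A M n : measurable A ->
  (forall x, A x -> (phi x <= M)%R) ->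
  exp_int A n <= (expR (n%:R * M))%:E * mu n A.
Proof.
move=> mA AM; rewrite -integral_cst//; apply: ge0_le_integral => //.
by move=> x /AM phiM; rewrite lee_fin ler_expR ler_wpM2l.
Qed.

End truncated_exponential_integral.

Section large_deviations.
Context {R : realType} {X : ptopologicalType}.
Variables (mu : nat -> probability (borelType X) R) (J : X -> \bar R).
Variable phi : X -> R.
Hypotheses (hLDP : satisfies_LDP mu J) (hphi : upper_semicontinuous phi).
Let S := ereal_sup (range (fun x : X => (phi x)%:E - J x)).

(** Where [phi >= a], the bound [phi - J <= c] forces [J >= a - c]; upper semicontinuity makes this
    set closed, so the LDP upper bound applies. *)
Lemma exp_rate_superlevel (a c : R) : S < c%:E ->
  exp_rate (fun n => mu n [set x | (a <= phi x)%R]) <= (c - a)%:E.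
Proof.
case: hLDP => J0 _ upper _ Sc.
apply: le_trans (upper _ (closed_usc_ge hphi (a := a))) _.
rewrite leeNl; apply: le_ereal_inf_tmp => _ [x /= ax <-].
have : (phi x)%:E - J x <= c%:E.
  by apply: le_trans (ltW Sc); apply: ereal_sup_ubound; exists x.
have := J0 x; case: (J x) => [r| |]// _; last by rewrite leey.
by rewrite -EFinB !lee_fin; lra.
Qed.

(* One [d] of the slack [2 * d] is the width of a slice; the other makes the
   rate bound [c - a] on [phi >= a] strict. *)
Lemma exp_rate_slices (c d : R) (k : nat) : S < c%:E -> (0 < d)%R ->
  exp_rate (exp_int mu phi (phi @^-1` `]-oo, (c + k%:R * d)%R]))
    <= (c + 2 * d)%:E.
Proof.
move=> Sc d0; elim: k => [|k IH].
  apply: (@le_trans _ _ c%:E); last by rewrite lee_fin; lra.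
  apply: exp_rate_le; apply: nearW => n.
  have mA := measurable_usc_itv hphi `]-oo, (c + 0 * d)%R].
  (* The integrand is at most [expR (n * c)] here, and a probability is at most 1. *)
  apply: le_trans (exp_int_le_bound (M := c) mu hphi n mA _) _.
    by move=> x; rewrite /= in_itv/= mul0r addr0.
  by rewrite -[leRHS]mule1 lee_pmul2l// ?lte_fin ?expR_gt0// probability_le1.
set a := (c + k%:R * d)%R in IH *.
have -> : (c + k.+1%:R * d = a + d)%R by rewrite -natr1 /a; lra.
have -> : phi @^-1` `]-oo, (a + d)%R]
    = phi @^-1` `]-oo, a] `|` phi @^-1` `]a, (a + d)%R].
  apply/seteqP; split=> x /=; rewrite !in_itv/=.
    by case: (leP (phi x) a) => ?; [left|right].
  by case=> [|/andP[]]; lra.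
have m1 := measurable_usc_itv hphi `]-oo, a].
have m2 := measurable_usc_itv hphi `]a, (a + d)%R].
rewrite (exp_int_setU _ hphi)//; last first.
  apply/disj_setPS => x [] /=; rewrite !in_itv/=; lra.
apply: exp_rateD IH _ => [n|n|]; [exact: exp_int_ge0|exact: exp_int_ge0|].
apply: exp_rate_le.
have := exp_rate_superlevel a Sc.
have ltca : (c - a)%:E < (c - a + d)%:E by rewrite lte_fin ltrDl.
move=> /le_lt_trans => /(_ _ ltca) /exp_rate_lt => /(_ (fun=> measure_ge0 _ _)).
apply: filterS => n mun.
apply: le_trans (exp_int_le_bound (M := (a + d)%R) mu hphi n m2 _) _.
  by move=> x /=; rewrite in_itv/= => /andP[].
(* The first summand bounds the integrand on the slice, the second the measure of [phi >= a], which
   contains the slice; the level [a] cancels. *)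
have -> : (n%:R * (c + 2 * d) = n%:R * (a + d) + n%:R * (c - a + d))%R by lra.
rewrite expRD EFinM lee_pmul2l// ?lte_fin ?expR_gt0//.
apply: le_trans mun; apply: le_measure; rewrite ?inE//.
  by rewrite -preimage_itvcy; exact: measurable_usc_itv.
by move=> x /=; rewrite in_itv/= => /andP[/ltW].
Qed.

Lemma exp_rate_sublevel (M : R) :
  exp_rate (exp_int mu phi (phi @^-1` `]-oo, M])) <= S.
Proof.
apply: le_EFin_gt => c Sc; apply/lee_addgt0Pr => e e0.
(* Slices of width [e / 2] make the slack [2 * d] equal to [e]; finitely many of them reach [M]. *)
have e20 : (0 < e / 2)%R by rewrite divr_gt0.
have [k Mk] : exists k : nat, (M <= c + k%:R * (e / 2))%R.
  exists (Num.truncn ((M - c) / (e / 2))).+1.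
  by rewrite -lerBlDl -ler_pdivrMr// ltW// truncnS_gt.
have -> : c%:E + e%:E = (c + 2 * (e / 2))%:E by rewrite -EFinD; congr (_%:E); lra.
apply: le_trans (exp_rate_slices k Sc e20).
apply: le_exp_rate => [n|n]; first exact: exp_int_ge0.
apply: le_exp_int => //; try exact: measurable_usc_itv.
by move=> x /=; rewrite !in_itv/= => /le_trans; apply.
Qed.

End large_deviations.

(* The limit in M exists in \bar R because the limsup is nonincreasing in M. *)
Theorem lemma2p1 (R : realType) (X : ptopologicalType)
    (mu : nat -> probability (borelType X) R) (J : X -> \bar R) (phi : X -> R)
    (hLDP : satisfies_LDP mu J) (hphi : upper_semicontinuous phi) :
  limn_esup (fun n : nat =>
      (n%:R^-1)%:E * lne (\int[mu n]_x (expR (n%:R * phi x))%:E))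
    <= ereal_sup (range (fun x : X => (phi x)%:E - J x))
  <->
  lim ((limn_esup (fun n : nat =>
      (n%:R^-1)%:E *
      lne (\int[mu n]_x
             (expR (n%:R * phi x) * \1_[set y : X | (M < phi y)%R] x)%:E)))
    @[M --> +oo%R])
    <= ereal_sup (range (fun x : X => (phi x)%:E - J x)).
Proof.
set S := ereal_sup _.
pose T M := phi @^-1` `]M, +oo[.
pose tail M := exp_rate (exp_int mu phi (T M)).
have mT M : measurable (T M : set (borelType X)) by exact: measurable_usc_itv.
have -> : (fun M => limn_esup (fun n : nat => (n%:R^-1)%:E * lne (\int[mu n]_x
    (expR (n%:R * phi x) * \1_[set y : X | (M < phi y)%R] x)%:E))) = tail.
  apply/funext => M; rewrite /tail /exp_rate; congr limn_esup.
  by apply/funext => n; rewrite -exp_int_indic /T set_itvoy.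
rewrite -/(exp_rate (exp_int mu phi setT)).
have tail_le : {homo tail : M N / (M <= N)%R >-> N <= M}.
  move=> M N MN; apply: le_exp_rate => n; first exact: exp_int_ge0.
  apply: le_exp_int => // x; rewrite /T /= !in_itv/= !andbT.
  exact: le_lt_trans.
(* By monotonicity the limit is the infimum of [tail] over all [M], so any single tail bounds it
   from above. *)
rewrite (cvg_lim _ (nonincreasing_cvge tail_le))//.
split=> [totS|tailS].
  apply: le_trans totS; apply: (@le_trans _ _ (tail 0%R)).
    by apply: ereal_inf_lbound; exists 0%R.
  by apply: le_exp_rate => n; [exact: exp_int_ge0|exact: le_exp_int].
apply: le_EFin_gt => c Sc.
(* Since [c] is strictly above the infimum, one cut-off [M] already has tail rate below [c]; the
   integral is split there. *)
have /ereal_inf_lt[_ [M _ <-] tailc] := le_lt_trans tailS Sc.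
have -> : [set: X] = phi @^-1` `]-oo, M] `|` T M.
  by rewrite -preimage_setU -itv_bndbnd_setU//= set_itvNyy preimage_setT.
rewrite (exp_int_setU _ hphi)//; [|exact: measurable_usc_itv|].
  apply: exp_rateD (ltW tailc) => [n|n|]; try exact: exp_int_ge0.
  by apply: le_trans (ltW Sc); exact: exp_rate_sublevel.
by apply/disj_setPS => x []; rewrite /T /= !in_itv/= andbT; lra.
Qed.
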